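(* Let $A\in\mathbb{Z}^{m\times n}$ with $A\notin\mathbb{N}^{m\times n}$, and let $b\in\mathbb{Z}^m$ be such that $\mathbf{P}:=\{x\in\mathbb{R}^n: Ax=b,\ x\geq0\}$ is a (compact) convex polytope. Let $\alpha\in\mathbb{N}^n$ be such that $$\widehat{A}_{j;k}:=A_{j;k}+\alpha_k\geq0\quad\text{for all }1\leq j\leq m,\ 1\leq k\leq n.$$ Since $\mathbf{P}$ is a (compact) polytope, $$\rho:=\max_{x\in\mathbb{N}^n,\,Ax=b}\Big\{\sum_{k=1}^n\alpha_kx_k\Big\}<\infty,$$ and in particular $\rho\in\mathbb{N}$. Define $\widehat{b}\in\mathbb{N}^m$ by $\widehat{b}:=b+\rho\,\mathrm{e}_m\geq0$. Then the solutions $x\in\mathbb{N}^n$ to the original system $Ax=b$ are in one-to-one correspondence with the solutions $(x,u)\in\mathbb{N}^n\times\mathbb{N}$ to the extended system $$\widehat{A}x+\mathrm{e}_mu=\widehat{b},\qquad \alpha'x+u=\rho.$$ Hence the existence of a solution $x\in\mathbb{N}^n$ to $Ax=b$ is equivalent to the existence of a solution $(x,u)\in\mathbb{N}^{n+1}$ to $$\begin{pmatrix}\widehat{b}\\ \rho\end{pmatrix}=A^\star\begin{pmatrix}x\\ u\end{pmatrix}\quad\text{with}\quad A^\star:=\begin{pmatrix}\widehat{A}&\mathrm{e}_m\\ \alpha'&1\end{pmatrix},$$ and the new matrix $A^\star\in\mathbb{N}^{(m+1)\times(n+1)}$ has only nonnegative integer entries.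
   Context: $\mathbb{N}=\{0,1,2,\dots\}$; prime denotes transpose; inequalities between vectors are entrywise; $\mathrm{e}_m:=(1,\dots,1)'\in\mathbb{N}^m$ is the all-ones vector; $A_{j;k}$ is the entry of $A$ in row $j$, column $k$, and $\widehat{A}\in\mathbb{N}^{m\times n}$ is the matrix with entries $\widehat{A}_{j;k}$.
   Formalization: If Ax=b has no solution x in N^n, the maximum defining ρ is over an empty set and undefined; in that case ρ may be any natural number, and b̂≥0 is claimed only for some such ρ, while the correspondence, the equivalence and A*≥0 are claimed for every such ρ. *)

(* Defs.v *)
From mathcomp Require Import all_boot all_order all_algebra.
From mathcomp Require Import all_classical all_reals all_analysis.

Set Implicit Arguments.
Unset Strict Implicit.
Unset Printing Implicit Defensive.

Import Order.TTheory GRing.Theory Num.Theory.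
Import numFieldNormedType.Exports.

Local Open Scope classical_set_scope.
Local Open Scope ring_scope.

(* Elements of N^n are column vectors over nat; linear systems live over int,
   so natural vectors are embedded entrywise. *)
Definition vecZ (p q : nat) (x : 'M[nat]_(p, q)) : 'M[int]_(p, q) :=
  map_mx Posz x.

Definition polyhedron (R : realType) (m n : nat)
    (A : 'M[int]_(m, n)) (b : 'cV[int]_m) : set 'cV[R]_n :=
  [set x | map_mx intr A *m x = map_mx intr b /\ forall k, 0 <= x k ord0].

Definition natSolutions (m n : nat)
    (A : 'M[int]_(m, n)) (b : 'cV[int]_m) : set 'cV[nat]_n :=
  [set x | A *m vecZ x = b].

Definition weight (n : nat) (alpha x : 'cV[nat]_n) : nat :=
  (\sum_(k < n) alpha k ord0 * x k ord0)%N.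

Definition isMaxOn (T : Type) (f : T -> nat) (S : set T) (r : nat) : Prop :=
  (exists2 x, S x & f x = r) /\ (forall x, S x -> (f x <= r)%N).

(* [rho] is the maximum of the weight over the natural solutions of A x = b.
   When there is no such solution the maximum is over the empty set and [rho]
   is left unconstrained, so that what is proved for all such [rho] holds
   whatever value is given to the empty maximum. *)
Definition isRho (m n : nat) (A : 'M[int]_(m, n)) (b : 'cV[int]_m)
    (alpha : 'cV[nat]_n) (rho : nat) : Prop :=
  natSolutions A b !=set0 -> isMaxOn (weight alpha) (natSolutions A b) rho.

Definition hatA (m n : nat) (A : 'M[int]_(m, n)) (alpha : 'cV[nat]_n) :
    'M[int]_(m, n) :=
  \matrix_(j, k) (A j k + (alpha k ord0)%:Z).

Definition ones (m : nat) : 'cV[nat]_m := const_mx 1%N.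

Definition hatb (m : nat) (b : 'cV[int]_m) (rho : nat) : 'cV[int]_m :=
  b + rho%:Z *: vecZ (ones m).

Definition extSolutions (m n : nat) (A : 'M[int]_(m, n)) (b : 'cV[int]_m)
    (alpha : 'cV[nat]_n) (rho : nat) : set ('cV[nat]_n * nat) :=
  [set xu | hatA A alpha *m vecZ xu.1 + xu.2%:Z *: vecZ (ones m) = hatb b rho
         /\ (weight alpha xu.1 + xu.2)%N = rho].

Definition Astar (m n : nat) (A : 'M[int]_(m, n)) (alpha : 'cV[nat]_n) :
    'M[int]_(m + 1, n + 1) :=
  block_mx (hatA A alpha) (vecZ (ones m)) (vecZ alpha)^T 1%:M.

(* Main.v *)
Require Import Defs.
From mathcomp Require Import all_boot all_order all_algebra.
From mathcomp Require Import all_classical all_reals all_analysis.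

Set Implicit Arguments.
Unset Strict Implicit.
Unset Printing Implicit Defensive.

Import Order.TTheory GRing.Theory Num.Theory.
Import numFieldNormedType.Exports.

Local Open Scope classical_set_scope.
Local Open Scope ring_scope.

(** Since [hatA] adds the row [alpha'] to every row of [A], one has
    [hatA x = A x + (alpha' x) e_m]; given [alpha' x + u = rho], the extended
    equation [hatA x + u e_m = b + rho e_m] therefore reduces to [A x = b], and
    [u = rho - alpha' x] is a natural number because [rho] is a maximum. That
    maximum exists because [x |-> alpha' x] is continuous on the compact
    polytope, and [hatb = hatA x >= 0] at a maximizer [x]. *)

Lemma natr_int (z : int) : (z \is a Num.nat) = (0 <= z).
Proof. by rewrite natrEint -[z]intz intr_int. Qed.

Lemma Posz_sum (I : Type) (r : seq I) (P : pred I) (F : I -> nat) :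
  Posz (\sum_(i <- r | P i) F i)%N = \sum_(i <- r | P i) Posz (F i).
Proof. by rewrite (big_morph Posz PoszD (erefl 0%Z)). Qed.

Lemma hatA_mul (m n : nat) (A : 'M[int]_(m, n)) (alpha x : 'cV[nat]_n) :
  hatA A alpha *m vecZ x
  = A *m vecZ x + (weight alpha x)%:Z *: vecZ (ones m).
Proof.
apply/matrixP => j i; rewrite !mxE /= mulr1 /weight Posz_sum -big_split /=.
by apply: eq_bigr => k _; rewrite !mxE mulrDl (ord1 i) PoszM.
Qed.

Lemma extSolutionsE (m n : nat) (A : 'M[int]_(m, n)) (b : 'cV[int]_m)
    (alpha x : 'cV[nat]_n) (u rho : nat) :
  extSolutions A b alpha rho (x, u)
  <-> natSolutions A b x /\ (weight alpha x + u)%N = rho.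
Proof.
rewrite /extSolutions /natSolutions /hatb /=.
split=> -[Ax wu]; split => //; move: Ax;
  rewrite hatA_mul -addrA -scalerDl -PoszD wu.
  exact: addIr.
by move=> ->.
Qed.

(** The upper block of the product is the extended equation; the lower one is a 1 x 1 integer
    matrix, and injectivity of [Posz] returns its equation to [nat]. *)
Lemma Astar_mul_eq (m n : nat) (A : 'M[int]_(m, n)) (b : 'cV[int]_m)
    (alpha x : 'cV[nat]_n) (u rho : nat) :
  col_mx (hatb b rho) (rho%:Z)%:M
    = Astar A alpha *m col_mx (vecZ x) (u%:Z)%:M
  <-> extSolutions A b alpha rho (x, u).
Proof.
have weightM : (vecZ alpha)^T *m vecZ x = (weight alpha x)%:Z%:M.
  apply/matrixP => i j; rewrite !mxE !ord1 /= mulr1n /weight Posz_sum.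
  by apply: eq_bigr => k _; rewrite !mxE PoszM.
rewrite /Astar mul_block_col mul1mx weightM mul_mx_scalar -raddfD /=.
split=> [/eq_col_mx[eq_b /matrixP/(_ ord0 ord0)]|[/= eq_b wu]].
  rewrite !mxE !mulr1n => -[wu].
  by split.
by rewrite -PoszD wu eq_b.
Qed.

Lemma hatA_nat (m n : nat) (A : 'M[int]_(m, n)) (alpha : 'cV[nat]_n) :
  (forall j k, 0 <= A j k + (alpha k ord0)%:Z) ->
  hatA A alpha \is a mxOver Num.nat.
Proof. by move=> h; apply/mxOverP => j k; rewrite mxE natr_int. Qed.

Lemma vecZ_nat (p q : nat) (x : 'M[nat]_(p, q)) : vecZ x \is a mxOver Num.nat.
Proof. by apply/mxOverP => i j; rewrite mxE natr_int. Qed.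

Lemma Astar_nat (m n : nat) (A : 'M[int]_(m, n)) (alpha : 'cV[nat]_n) :
  (forall j k, 0 <= A j k + (alpha k ord0)%:Z) ->
  Astar A alpha \is a mxOver Num.nat.
Proof.
move=> h; apply/mxOverP => i j; rewrite /Astar.
case: (split_ordP i) => i' ->; case: (split_ordP j) => j' ->.
- by rewrite block_mxEul; apply/mxOverP/hatA_nat.
- by rewrite block_mxEur; apply/mxOverP/vecZ_nat.
- by rewrite block_mxEdl mxE; apply/mxOverP/vecZ_nat.
- by rewrite block_mxEdr mxE natr_int; case: eqP.
Qed.

Lemma hatb_nat (m n : nat) (A : 'M[int]_(m, n)) (b : 'cV[int]_m)
    (alpha : 'cV[nat]_n) (rho : nat) :
  (forall j k, 0 <= A j k + (alpha k ord0)%:Z) ->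
  isRho A b alpha rho -> natSolutions A b !=set0 ->
  hatb b rho \is a mxOver Num.nat.
Proof.
(* A maximizer [x] has weight exactly [rho], so its slack is 0 and [hatb] equals [hatA] times [x], a
   product of nonnegative matrices. *)
move=> h hrho /hrho[[x Ax <-] _].
by rewrite /hatb -Ax -hatA_mul mxOverM ?hatA_nat ?vecZ_nat.
Qed.

Lemma polyhedron_vecZ (R : realType) (m n : nat) (A : 'M[int]_(m, n))
    (b : 'cV[int]_m) (x : 'cV[nat]_n) :
  natSolutions A b x ->
  (polyhedron A b : set 'cV[R]_n) (map_mx intr (vecZ x)).
Proof. by move=> <-; split=> [|k]; rewrite ?map_mxM // !mxE ler0z. Qed.

(** The real maximum over the polytope need not be attained at an integer point, so the extreme
    value theorem supplies only an upper bound here. *)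
Lemma weight_bounded (R : realType) (m n : nat) (A : 'M[int]_(m, n))
    (b : 'cV[int]_m) (alpha : 'cV[nat]_n) :
  compact (polyhedron A b : set 'cV[R]_n) ->
  exists N, forall x, natSolutions A b x -> (weight alpha x <= N)%N.
Proof.
move=> cP; have [P0|/set0P Pne] := eqVneq (polyhedron A b : set 'cV[R]_n) set0.
  by exists 0%N => x /(@polyhedron_vecZ R); rewrite P0.
(* The weight extended to real vectors, as a finite sum of constants times coordinate maps. *)
pose f (y : 'cV[R]_n) : R := \sum_(k < n) (alpha k ord0)%:R * y k ord0.
have cf : continuous f.
  apply: continuous_big => [|k _]; first exact: add_continuous.
  move=> y.
  apply: (@cvgM R _ (nbhs y) _ (cst _) (fun z : 'cV[R]_n => z k ord0)).
    exact: cvg_cst.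
  exact: coord_continuous.
have [c _ fc] := compact_EVT_max Pne cP (continuous_subspaceT cf).
exists (Num.trunc (f c)) => x /(@polyhedron_vecZ R) Px.
have {Px}: f (map_mx intr (vecZ x)) <= f c by apply: fc; rewrite inE.
have -> : f (map_mx intr (vecZ x)) = (weight alpha x)%:R.
  by rewrite natr_sum; apply: eq_bigr => k _; rewrite !mxE natrM.
move=> le_fc; rewrite -ltnS -(ltr_nat R); apply: (le_lt_trans le_fc).
(* [Num.trunc] brackets its argument only when that is nonnegative; here [f c] dominates a natural
   weight. *)
have /trunc_itv/andP[] // : 0 <= f c by apply: le_trans le_fc.
Qed.

Lemma bounded_isMaxOn (T : Type) (f : T -> nat) (S : set T) (N : nat) :
  S !=set0 -> (forall x, S x -> (f x <= N)%N) -> exists r, isMaxOn f S r.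
Proof.
move=> [x0 Sx0] ub.
(* Classical reflection makes attainability of a value boolean, as [ex_maxnP] requires. *)
pose P r := `[< exists2 x, S x & f x = r >].
have exP : exists r, P r by exists (f x0); apply/asboolP; exists x0.
have ubP r : P r -> (r <= N)%N by move=> /asboolP[x Sx <-]; exact: ub.
have [r /asboolP Pr maxr] := ex_maxnP exP ubP.
by exists r; split=> // x Sx; apply: maxr; apply/asboolP; exists x.
Qed.

Theorem mainTheorem6 (R : realType) (m n : nat)
    (A : 'M[int]_(m, n)) (b : 'cV[int]_m) (alpha : 'cV[nat]_n)
    (hA : A \isn't a mxOver Num.nat)
    (hP : compact (polyhedron A b : set 'cV[R]_n))
    (halpha : forall (j : 'I_m) (k : 'I_n), 0 <= A j k + (alpha k ord0)%:Z) :
  (exists2 rho : nat, isRho A b alpha rho & hatb b rho \is a mxOver Num.nat) /\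
  (forall rho : nat, isRho A b alpha rho ->
    [/\ natSolutions A b !=set0 -> hatb b rho \is a mxOver Num.nat,
        set_bij (extSolutions A b alpha rho) (natSolutions A b) fst,
        (exists x : 'cV[nat]_n, A *m vecZ x = b) <->
        (exists (x : 'cV[nat]_n) (u : nat),
            col_mx (hatb b rho) (rho%:Z)%:M =
              Astar A alpha *m col_mx (vecZ x) (u%:Z)%:M) &
        Astar A alpha \is a mxOver Num.nat]).
Proof.
split=> [|rho hrho]; last split.
- have [S0|/set0P Sne] := eqVneq (natSolutions A b) set0.
    (* Without natural solutions every [rho] satisfies [isRho]; this one is at least each [|b_j|],
       hence [b_j + rho >= 0]. *)
    exists (\sum_j `|b j ord0|)%N; first by rewrite /isRho S0 => -[].
    apply/mxOverP => j i; rewrite !mxE /= mulr1 natr_int ord1 (bigD1 j) //=.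
    rewrite PoszD addrA addr_ge0 // -lerBlDl sub0r abszE -normrN.
    exact: ler_norm.
  have [N ub] := weight_bounded alpha hP.
  have [rho hrho] := bounded_isMaxOn Sne ub.
  by exists rho; [|apply: hatb_nat Sne].
- exact: hatb_nat.
- split=> [[x u] /extSolutionsE[]//| |].
    (* Injectivity: [x] determines [u] through [weight alpha x + u = rho]. *)
    move=> [x u] [y v] /[!inE] /extSolutionsE[_ wu] /extSolutionsE[_ wv] /= xy.
    by move: wv; rewrite -xy -wu => /addnI ->.
  (* Surjectivity: [x] itself shows that solutions exist, so [rho] is a true maximum and the
     truncated subtraction [rho - weight alpha x] is exact. *)
  move=> x Sx; have [_ /(_ x Sx) le_rho] := hrho (ex_intro _ x Sx).
  exists (x, (rho - weight alpha x)%N) => //.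
  by apply/extSolutionsE; rewrite subnKC.
- split=> [[x Sx]|[x [u /Astar_mul_eq/extSolutionsE[Sx _]]]]; last by exists x.
  have [_ /(_ x Sx) le_rho] := hrho (ex_intro _ x Sx).
  exists x, (rho - weight alpha x)%N.
  by apply/Astar_mul_eq/extSolutionsE; rewrite subnKC.
- exact: Astar_nat.
Qed.
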